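(* Consider the $f$-plane problem with centripetal forces (system (E), incompressibility (M), boundary conditions (B1)–(B3) as set out in the context). Assume that the vorticity vector $\mathbf{\Upsilon}=(\Upsilon_1,\Upsilon_2,\Upsilon_3)$ is constant and satisfies $$\Upsilon_2+\hat f\neq 0,\qquad \Upsilon_3+f\neq 0 .$$ Then there is no bounded solution $(u,v,w,P,\eta)$ of (E), (M), (B1), (B2), (B3).
   Context: Constants: $\Omega>0$ (rotational speed of the Earth), $R>0$ (radius of the Earth), $g>0$ (gravitational acceleration), $\rho>0$ (constant water density), $P_{atm}$ (constant atmospheric pressure), $d>0$ (the flat bed is $z=-d$), $c>0$ (wave speed), $L>0$ (wave period). The latitude $\phi\in(-\pi/2,\pi/2)$ is fixed, and $f=2\Omega\sin\phi$, $\hat f=2\Omega\cos\phi$ are treated as constants ($\hat f\ne 0$). Free surface and fluid domain: the free surface is $z=\eta(x-ct)$, where $\eta$ is an $L$-periodic function of one real variable with $\eta>-d$ and zero mean $\int_0^L\eta(s)\,ds=0$; the wave crest (maximum of $\eta$) is located at $0$ and $\eta(0)>0$. The surface does not depend on $y$. The fluid domain at time $t$ is $\{(x,y,z): x,y\in\mathbb{R},\ -d\le z\le \eta(x-ct)\}$. The velocity field $\mathbf{u}=(u,v,w)$ and the pressure $P$ are functions of $(x,y,z,t)$, sufficiently smooth (classical) in the fluid domain up to its boundary. (E) ($f$-plane equations with centripetal terms): $$u_t+uu_x+vu_y+wu_z+\hat f w-fv=-\tfrac1\rho P_x,$$ $$v_t+uv_x+vv_y+wv_z+fu+\tfrac{\hat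 f^2}{4}y+\tfrac{\hat f f}{4}R=-\tfrac1\rho P_y,$$ $$w_t+uw_x+vw_y+ww_z-\hat f u-\tfrac{\hat f^2}{4}R=-\tfrac1\rho P_z-g.$$ (M) (incompressibility): $u_x+v_y+w_z=0$. (B1) $P=P_{atm}$ on $z=\eta(x-ct)$. (B2) $w=(u-c)\eta_x$ on $z=\eta(x-ct)$. (B3) $w=0$ on $z=-d$. The vorticity vector is $\mathbf{\Upsilon}=(\Upsilon_1,\Upsilon_2,\Upsilon_3)=(w_y-v_z,\ u_z-w_x,\ v_x-u_y)$; ''constant'' means that it does not depend on $(x,y,z,t)$. A solution is called bounded if its velocity field $(u,v,w)$ is bounded on the fluid domain. *)

(* Defs.v *)
From Stdlib Require Import Reals.
From Coquelicot Require Import Coquelicot.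
Open Scope R_scope.

(** Scalar fields in the variables (x, y, z, t).  They are total functions; only
    their values on the fluid domain are ever constrained. *)
Definition field := R -> R -> R -> R -> R.

Definition uncurry4 (h : field) : R * R * R * R -> R :=
  fun p => let '(x, y, z, t) := p in h x y z t.

Definition Dx (h : field) : field := fun x y z t => Derive (fun s => h s y z t) x.
Definition Dy (h : field) : field := fun x y z t => Derive (fun s => h x s z t) y.
Definition Dz (h : field) : field := fun x y z t => Derive (fun s => h x y s t) z.
Definition Dt (h : field) : field := fun x y z t => Derive (fun s => h x y z s) t.

(** [Derive] is a junk value where the derivative does not exist. *)
Definition has_partials (h : field) (x y z t : R) : Prop :=
  ex_derive (fun s => h s y z t) x /\ ex_derive (fun s => h x s z t) y /\
  ex_derive (fun s => h x y s t) z /\ ex_derive (fun s => h x y z s) t.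

Definition in_fluid (d c : R) (eta : R -> R) (x y z t : R) : Prop :=
  - d <= z <= eta (x - c * t).

(** As [eta] is continuous, these are the interior points of the space-time
    fluid domain. *)
Definition in_interior (d c : R) (eta : R -> R) (x y z t : R) : Prop :=
  - d < z < eta (x - c * t).

Definition fluid_set (d c : R) (eta : R -> R) (p : R * R * R * R) : Prop :=
  let '(x, y, z, t) := p in in_fluid d c eta x y z t.

Definition extends_to_boundary (d c : R) (eta : R -> R) (h : field) : Prop :=
  exists k : field,
    continuous_on (fluid_set d c eta) (uncurry4 k) /\
    forall x y z t, in_interior d c eta x y z t -> k x y z t = h x y z t.

(** All partial derivatives of [h] of order at most [n] exist in the interior
    and extend continuously to the closed domain.  Differentiating only in the
    interior avoids boundary points, such as the crest, that are isolated on
    their line in the x direction. *)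
Fixpoint partials_extend (n : nat) (d c : R) (eta : R -> R) (h : field) : Prop :=
  extends_to_boundary d c eta h /\
  match n with
  | O => True
  | S m =>
      (forall x y z t, in_interior d c eta x y z t -> has_partials h x y z t) /\
      partials_extend m d c eta (Dx h) /\ partials_extend m d c eta (Dy h) /\
      partials_extend m d c eta (Dz h) /\ partials_extend m d c eta (Dt h)
  end.

(** Class C^n up to the boundary.  The first conjunct makes the boundary values
    of [h] itself, which enter the boundary conditions, the limits from inside. *)
Definition smooth_upto_boundary (n : nat) (d c : R) (eta : R -> R) (h : field)
    : Prop :=
  continuous_on (fluid_set d c eta) (uncurry4 h) /\ partials_extend n d c eta h.

Definition coriolis (Omega phi : R) : R := 2 * Omega * sin phi.
Definition coriolis_hat (Omega phi : R) : R := 2 * Omega * cos phi.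

Record free_surface (d L : R) (eta : R -> R) : Prop := {
  surface_differentiable : forall s, ex_derive eta s;
  surface_periodic : forall s, eta (s + L) = eta s;
  surface_above_bed : forall s, - d < eta s;
  surface_zero_mean : is_RInt eta 0 L 0;
  surface_crest : forall s, eta s <= eta 0;
  surface_crest_pos : 0 < eta 0 }.

Definition material_derivative (u v w h : field) : field := fun x y z t =>
  Dt h x y z t + u x y z t * Dx h x y z t + v x y z t * Dy h x y z t
  + w x y z t * Dz h x y z t.

(** For fields of class C^2 up to the boundary, an identity between first
    derivatives in the interior is the same as its continuous extension to the
    closed domain; hence the differential equations are stated in the interior. *)
Record f_plane_solution (Omega Rad g rho Patm d c L phi : R)
    (u v w P : field) (eta : R -> R) : Prop := {
  sol_surface : free_surface d L eta;
  sol_smooth_u : smooth_upto_boundary 2 d c eta u;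
  sol_smooth_v : smooth_upto_boundary 2 d c eta v;
  sol_smooth_w : smooth_upto_boundary 2 d c eta w;
  sol_smooth_P : smooth_upto_boundary 2 d c eta P;
  sol_momentum_x : forall x y z t, in_interior d c eta x y z t ->
    material_derivative u v w u x y z t
      + coriolis_hat Omega phi * w x y z t - coriolis Omega phi * v x y z t
    = - (1 / rho) * Dx P x y z t;
  sol_momentum_y : forall x y z t, in_interior d c eta x y z t ->
    material_derivative u v w v x y z t
      + coriolis Omega phi * u x y z t
      + (coriolis_hat Omega phi) ^ 2 / 4 * y
      + coriolis_hat Omega phi * coriolis Omega phi / 4 * Rad
    = - (1 / rho) * Dy P x y z t;
  sol_momentum_z : forall x y z t, in_interior d c eta x y z t ->
    material_derivative u v w w x y z t
      - coriolis_hat Omega phi * u x y z t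
      - (coriolis_hat Omega phi) ^ 2 / 4 * Rad
    = - (1 / rho) * Dz P x y z t - g;
  sol_incompressible : forall x y z t, in_interior d c eta x y z t ->
    Dx u x y z t + Dy v x y z t + Dz w x y z t = 0;
  sol_dynamic : forall x y t, P x y (eta (x - c * t)) t = Patm;
  sol_kinematic : forall x y t,
    w x y (eta (x - c * t)) t
    = (u x y (eta (x - c * t)) t - c) * Derive (fun s => eta (s - c * t)) x;
  sol_bed : forall x y t, w x y (- d) t = 0 }.

Definition constant_vorticity (d c : R) (eta : R -> R) (u v w : field)
    (Y1 Y2 Y3 : R) : Prop :=
  forall x y z t, in_interior d c eta x y z t ->
    Dy w x y z t - Dz v x y z t = Y1 /\
    Dz u x y z t - Dx w x y z t = Y2 /\
    Dx v x y z t - Dy u x y z t = Y3.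

(** The bound is allowed to depend on the time. *)
Definition bounded_velocity (d c : R) (eta : R -> R) (u v w : field) : Prop :=
  forall t, exists B, forall x y z, in_fluid d c eta x y z t ->
    Rabs (u x y z t) <= B /\ Rabs (v x y z t) <= B /\ Rabs (w x y z t) <= B.

(* Main.v *)
(** Only the slab [- d < z < b] below the lowest surface level [b] matters.  The
    curl of the momentum equations says that the constant absolute vorticity
    [A = (Y1, Y2 + Fh, Y3 + F)] satisfies [A . grad u = A . grad v = A . grad w = 0].
    As [A] is transversal to the bed, where [w = 0], this forces [w = 0] in the slab.
    Incompressibility and the vorticity then turn the transport equations for [u]
    and [v] into a regular linear system with constant coefficients for the
    horizontal gradient of [u], which is therefore constant, and zero by
    boundedness.  Hence [u] and [v] do not depend on [y], and the centripetal term
    makes the pressure quadratic in [y] with nonzero leading coefficient.  At a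
    trough, where the slab touches the surface, this contradicts [P = Patm]. *)

From Stdlib Require Import Reals ZArith Lra Lia.
From Coquelicot Require Import Coquelicot.
Require Import Defs.
Open Scope R_scope.

(** * Limits of fields along curves *)

Lemma filterlim_pair_locally {T : Type} {U V : UniformSpace}
    (F : (T -> Prop) -> Prop) {FF : Filter F} (f : T -> U) (g : T -> V) a b :
  filterlim f F (locally a) -> filterlim g F (locally b) ->
  filterlim (fun s => (f s, g s)) F (locally (a, b)).
Proof.
  intros Hf Hg Q [eps HQ].
  unfold filtermap.
  apply (filter_imp (fun s => ball a eps (f s) /\ ball b eps (g s))).
  - intros s Hs. apply HQ, Hs.
  - apply filter_and; [exact (Hf _ (locally_ball a eps)) | exact (Hg _ (locally_ball b eps))].
Qed.

(** Continuity on [D] only controls limits within [D], so the curve is required to stay in [D]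
    eventually. This form also covers the one-sided approach to the bed and to the surface. *)
Lemma filterlim_field_within {T : Type} (F : (T -> Prop) -> Prop) {FF : Filter F}
    (D : R * R * R * R -> Prop) (h : field) (X Y Z S : T -> R) x y z t :
  continuous_on D (uncurry4 h) -> D (x, y, z, t) ->
  filterlim X F (locally x) -> filterlim Y F (locally y) ->
  filterlim Z F (locally z) -> filterlim S F (locally t) ->
  F (fun s => D (X s, Y s, Z s, S s)) ->
  filterlim (fun s => h (X s) (Y s) (Z s) (S s)) F (locally (h x y z t)).
Proof.
  intros Hc HD HX HY HZ HS HF Q HQ.
  assert (Hp : filterlim (fun s => (X s, Y s, Z s, S s)) F (locally (x, y, z, t))).
  { repeat apply filterlim_pair_locally; assumption. }
  specialize (Hp _ (Hc _ HD _ HQ)). unfold filtermap in *.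
  generalize (filter_and _ _ Hp HF).
  apply filter_imp; intros s [H1 H2]. exact (H1 H2).
Qed.

Lemma locally_between (a b z : R) : a < z < b -> locally z (fun s => a < s < b).
Proof.
  intros Hz.
  assert (He : 0 < Rmin (z - a) (b - z)) by (apply Rmin_pos; lra).
  exists (mkposreal _ He); intros s Hs.
  unfold ball in Hs; simpl in Hs.
  unfold AbsRing_ball, abs, minus, plus, opp in Hs; simpl in Hs.
  apply Rabs_def2 in Hs.
  pose proof (Rmin_l (z - a) (b - z)); pose proof (Rmin_r (z - a) (b - z)); lra.
Qed.

(** * Regularity on a horizontal slab, and a chain rule in the plane *)

(** Tuples nest to the left, so [snd (fst p)] is the coordinate z; x, y and t range over all
    reals. *)
Definition slab (a b : R) (p : R * R * R * R) : Prop := a < snd (fst p) < b.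

Lemma slab_open (a b : R) p : slab a b p -> locally p (slab a b).
Proof.
  intros Hp. destruct (locally_between _ _ _ Hp) as [eps He].
  exists eps; intros q [[_ Hq] _]. exact (He _ Hq).
Qed.

(** Same recursion as [partials_extend], but on an open set: each derivative is itself continuous,
    and no extension to the boundary is involved. *)
Fixpoint slab_smooth (n : nat) (a b : R) (h : field) : Prop :=
  continuous_on (slab a b) (uncurry4 h) /\
  match n with
  | O => True
  | S m =>
      (forall x y z t, a < z < b -> has_partials h x y z t) /\
      slab_smooth m a b (Dx h) /\ slab_smooth m a b (Dy h) /\
      slab_smooth m a b (Dz h) /\ slab_smooth m a b (Dt h)
  end.

(** Below a lower bound [b] of [eta] the slab lies in the interior of the fluid domain. There the
    continuous extension agrees with the field, which thus inherits its continuity. *)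
Lemma partials_extend_slab (n : nat) (d c : R) (eta : R -> R) (b : R) (h : field) :
  (forall s, b <= eta s) -> partials_extend n d c eta h -> slab_smooth n (- d) b h.
Proof.
  intros Hb.
  assert (Hin : forall x y z t, - d < z < b -> in_interior d c eta x y z t).
  { intros x y z t Hz. specialize (Hb (x - c * t)). unfold in_interior; lra. }
  assert (H0 : forall h, extends_to_boundary d c eta h ->
    continuous_on (slab (- d) b) (uncurry4 h)).
  { intros h' [k [Hk Hkh]] [[[x y] z] t] Hp. unfold slab in Hp; simpl in Hp.
    simpl. rewrite <- (Hkh x y z t (Hin x y z t Hp)).
    apply (filterlim_within_ext _ (uncurry4 k)).
    { intros [[[x' y'] z'] t'] Hq. apply Hkh, Hin, Hq. }
    intros Q HQ. unfold filtermap, within.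
    assert (Hf : fluid_set d c eta (x, y, z, t)).
    { generalize (Hin x y z t Hp). unfold fluid_set, in_interior, in_fluid; lra. }
    generalize (Hk _ Hf _ HQ). unfold filtermap, within.
    apply filter_imp. intros [[[x' y'] z'] t'] H1 H2. apply H1.
    generalize (Hin x' y' z' t' H2). unfold fluid_set, in_interior, in_fluid; lra. }
  revert h; induction n as [|n IH]; intros h H.
  - split; [apply H0, H | exact I].
  - destruct H as (He & Hp & H1 & H2 & H3 & H4).
    split; [apply H0, He|].
    split; [intros; apply Hp, Hin; assumption|].
    repeat split; apply IH; assumption.
Qed.

Lemma slab_smooth_pred (n : nat) (a b : R) (h : field) :
  slab_smooth (S n) a b h -> slab_smooth n a b h.
Proof.
  revert h; induction n as [|n IH]; intros h H.
  - split; [apply H | exact I].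
  - destruct H as (He & Hp & H1 & H2 & H3 & H4).
    split; [exact He|]. split; [exact Hp|].
    repeat split; apply IH; assumption.
Qed.

(** The first partial derivative must exist nearby and be continuous at the point, the second need
    only exist at the point. This asymmetry makes it easy to add one variable at a time. *)
Lemma is_derive_comp_2d (f fx : R -> R -> R) (fy : R) (X Y : R -> R) (r X' Y' : R) :
  locally_2d (fun x y => is_derive (fun s => f s y) x (fx x y)) (X r) (Y r) ->
  is_derive (fun s => f (X r) s) (Y r) fy ->
  continuity_2d_pt fx (X r) (Y r) ->
  is_derive X r X' -> is_derive Y r Y' ->
  is_derive (fun s => f (X s) (Y s)) r (X' * fx (X r) (Y r) + Y' * fy).
Proof.
  intros Hx Hy Hc HX HY.
  apply locally_2d_locally in Hx. apply continuity_2d_pt_filterlim in Hc.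
  pose proof (is_derive_filterdiff f (X r) (Y r) fx fy Hx Hy Hc) as Hf.
  eapply filterdiff_ext_lin.
  - apply (filterdiff_comp'_2 X Y f r _ _
      (fun p q => plus (scal p (fx (X r) (Y r))) (scal q fy)) HX HY Hf).
  - intros s. unfold scal, plus; simpl; unfold mult; simpl. ring.
Qed.

(** * Differential calculus of fields on a slab *)

Section Slab.

Context {a b : R}.

Lemma filterlim_slab {T : Type} (F : (T -> Prop) -> Prop) {FF : Filter F}
    (n : nat) (h : field) (X Y Z S : T -> R) x y z t :
  slab_smooth n a b h -> a < z < b ->
  filterlim X F (locally x) -> filterlim Y F (locally y) ->
  filterlim Z F (locally z) -> filterlim S F (locally t) ->
  filterlim (fun s => h (X s) (Y s) (Z s) (S s)) F (locally (h x y z t)).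
Proof.
  intros Hs Hz HX HY HZ HS.
  apply (filterlim_field_within F (slab a b)); try assumption.
  - destruct n; apply Hs.
  - exact (HZ _ (locally_between _ _ _ Hz)).
Qed.

Lemma slab_is_derive (h : field) x y z t :
  slab_smooth 1 a b h -> a < z < b ->
  is_derive (fun s => h s y z t) x (Dx h x y z t) /\
  is_derive (fun s => h x s z t) y (Dy h x y z t) /\
  is_derive (fun s => h x y s t) z (Dz h x y z t) /\
  is_derive (fun s => h x y z s) t (Dt h x y z t).
Proof.
  intros (_ & Hp & _) Hz. destruct (Hp x y z t Hz) as (H1 & H2 & H3 & H4).
  repeat split; apply Derive_correct; assumption.
Qed.

Lemma locally_2d_left (Q : R -> Prop) (x y : R) :
  locally x Q -> locally_2d (fun u _ => Q u) x y.
Proof. intros [eps H]; exists eps; intros u v Hu _; apply H, Hu. Qed.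

Lemma locally_2d_right (Q : R -> Prop) (x y : R) :
  locally y Q -> locally_2d (fun _ v => Q v) x y.
Proof. intros [eps H]; exists eps; intros u v _ Hv; apply H, Hv. Qed.

Lemma slab_schwarz (h : field) x y z t :
  slab_smooth 2 a b h -> a < z < b ->
  Dx (Dy h) x y z t = Dy (Dx h) x y z t /\
  Dx (Dz h) x y z t = Dz (Dx h) x y z t /\
  Dy (Dz h) x y z t = Dz (Dy h) x y z t /\
  Dx (Dt h) x y z t = Dt (Dx h) x y z t /\
  Dy (Dt h) x y z t = Dt (Dy h) x y z t /\
  Dz (Dt h) x y z t = Dt (Dz h) x y z t.
Proof.
  intros (Hc & Hp & Hx & Hy & Hz & Ht) Hzab.
  pose proof (locally_between _ _ _ Hzab) as Hl.
  pose proof (proj1 (proj2 Hx)) as Hpx. pose proof (proj1 (proj2 Hy)) as Hpy.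
  pose proof (proj1 (proj2 Hz)) as Hpz. pose proof (proj1 (proj2 Ht)) as Hpt.
  destruct Hx as (_ & _ & Hxx & Hxy & Hxz & Hxt).
  destruct Hy as (_ & _ & Hyx & Hyy & Hyz & Hyt).
  destruct Hz as (_ & _ & Hzx & Hzy & Hzz & Hzt).
  destruct Ht as (_ & _ & Htx & Hty & Htz & Htt).
  (** [slice] freezes two of the four variables, [h12] and [h21] are the mixed derivatives to be
      equated, [X Y Z S] are the coordinates as functions of the pair left free, and [near] provides
      a neighbourhood in which z stays in the slab. *)
  Ltac schwarz_on_slice slice h12 h21 X Y Z S near :=
    apply (Schwarz slice);
    [ generalize near; apply locally_2d_impl, locally_2d_forall; intros p q Hpq
    | apply continuity_2d_pt_filterlim; apply (filterlim_slab _ 0 h12 X Y Z S);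
      first [assumption | apply continuous_fst | apply continuous_snd | apply filterlim_const]
    | apply continuity_2d_pt_filterlim; apply (filterlim_slab _ 0 h21 X Y Z S);
      first [assumption | apply continuous_fst | apply continuous_snd | apply filterlim_const] ].
  (* For slices that freeze z, the slab condition holds at every point of the plane. *)
  pose (always := fun x y => locally_2d_forall (fun _ _ => a < z < b) x y (fun _ _ => Hzab)).
  split; [|split; [|split; [|split; [|split]]]].
  - schwarz_on_slice (fun p q => h p q z t) (Dx (Dy h)) (Dy (Dx h))
      (@fst R R) (@snd R R) (fun _ : R * R => z) (fun _ : R * R => t) (always x y).
    destruct (Hp p q z t Hpq) as (? & ? & _ & _), (Hpy p q z t Hpq) as (? & _),
      (Hpx p q z t Hpq) as (_ & ? & _).
    split; [|split; [|split]]; assumption.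
  - schwarz_on_slice (fun p q => h p y q t) (Dx (Dz h)) (Dz (Dx h))
      (@fst R R) (fun _ : R * R => y) (@snd R R) (fun _ : R * R => t) (locally_2d_right _ x z Hl).
    destruct (Hp p y q t Hpq) as (? & _ & ? & _), (Hpz p y q t Hpq) as (? & _),
      (Hpx p y q t Hpq) as (_ & _ & ? & _).
    split; [|split; [|split]]; assumption.
  - schwarz_on_slice (fun p q => h x p q t) (Dy (Dz h)) (Dz (Dy h))
      (fun _ : R * R => x) (@fst R R) (@snd R R) (fun _ : R * R => t) (locally_2d_right _ y z Hl).
    destruct (Hp x p q t Hpq) as (_ & ? & ? & _), (Hpz x p q t Hpq) as (_ & ? & _),
      (Hpy x p q t Hpq) as (_ & _ & ? & _).
    split; [|split; [|split]]; assumption.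
  - schwarz_on_slice (fun p q => h p y z q) (Dx (Dt h)) (Dt (Dx h))
      (@fst R R) (fun _ : R * R => y) (fun _ : R * R => z) (@snd R R) (always x t).
    destruct (Hp p y z q Hpq) as (? & _ & _ & ?), (Hpt p y z q Hpq) as (? & _),
      (Hpx p y z q Hpq) as (_ & _ & _ & ?).
    split; [|split; [|split]]; assumption.
  - schwarz_on_slice (fun p q => h x p z q) (Dy (Dt h)) (Dt (Dy h))
      (fun _ : R * R => x) (@fst R R) (fun _ : R * R => z) (@snd R R) (always y t).
    destruct (Hp x p z q Hpq) as (_ & ? & _ & ?), (Hpt x p z q Hpq) as (_ & ? & _),
      (Hpy x p z q Hpq) as (_ & _ & _ & ?).
    split; [|split; [|split]]; assumption.
  - schwarz_on_slice (fun p q => h x y p q) (Dz (Dt h)) (Dt (Dz h))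
      (fun _ : R * R => x) (fun _ : R * R => y) (@fst R R) (@snd R R) (locally_2d_left _ z t Hl).
    destruct (Hp x y p q Hpq) as (_ & _ & ? & ?), (Hpt x y p q Hpq) as (_ & _ & ? & _),
      (Hpz x y p q Hpq) as (_ & _ & _ & ?).
    split; [|split; [|split]]; assumption.
Qed.

(** The two-variable chain rule is used twice: first x and y move while z is frozen, then the
    horizontal and the vertical motion receive separate parameters [r1] and [r2], which are finally
    set equal to [r]. *)
Lemma slab_is_derive_line (h : field) x y z t p q s r :
  slab_smooth 1 a b h -> a < z + r * s < b ->
  is_derive (fun r => h (x + r * p) (y + r * q) (z + r * s) t) r
    (p * Dx h (x + r * p) (y + r * q) (z + r * s) t
     + q * Dy h (x + r * p) (y + r * q) (z + r * s) t
     + s * Dz h (x + r * p) (y + r * q) (z + r * s) t).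
Proof.
  intros Hh Hr.
  pose proof Hh as (_ & _ & Hx & Hy & Hz & _).
  assert (Haff : forall x p r : R, is_derive (fun r => x + r * p) r p)
    by (intros; auto_derive; [exact I | ring]).
  assert (Hcont : forall (x p : R) (r : R),
    filterlim (fun r : R => x + r * p) (locally r) (locally (x + r * p))).
  { intros x' p' r'. apply (ex_derive_continuous (fun r => x' + r * p')).
    eexists; apply Haff. }
  assert (Hplane : forall r1 r2, a < z + r2 * s < b ->
    is_derive (fun r1 => h (x + r1 * p) (y + r1 * q) (z + r2 * s) t) r1
      (p * Dx h (x + r1 * p) (y + r1 * q) (z + r2 * s) t
       + q * Dy h (x + r1 * p) (y + r1 * q) (z + r2 * s) t)).
  { intros r1 r2 Hr2.
    apply (is_derive_comp_2d (fun x y => h x y (z + r2 * s) t)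
      (fun x y => Dx h x y (z + r2 * s) t) _ (fun r => x + r * p) (fun r => y + r * q)).
    - apply locally_2d_forall; intros x' y'.
      exact (proj1 (slab_is_derive h x' y' _ t Hh Hr2)).
    - exact (proj1 (proj2 (slab_is_derive h _ _ _ t Hh Hr2))).
    - apply continuity_2d_pt_filterlim.
      apply (filterlim_slab _ 0 (Dx h) fst snd (fun _ => z + r2 * s) (fun _ => t));
        first [assumption | apply continuous_fst | apply continuous_snd | apply filterlim_const].
    - apply Haff.
    - apply Haff. }
  replace (p * _ + _ + _) with
    (1 * (p * Dx h (x + r * p) (y + r * q) (z + r * s) t
       + q * Dy h (x + r * p) (y + r * q) (z + r * s) t)
     + 1 * (s * Dz h (x + r * p) (y + r * q) (z + r * s) t)) by ring.
  apply (is_derive_comp_2d (fun r1 r2 => h (x + r1 * p) (y + r1 * q) (z + r2 * s) t)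
    (fun r1 r2 => p * Dx h (x + r1 * p) (y + r1 * q) (z + r2 * s) t
      + q * Dy h (x + r1 * p) (y + r1 * q) (z + r2 * s) t)
    _ (fun r => r) (fun r => r)).
  - generalize (locally_2d_right (fun r2 => a < z + r2 * s < b) r r
      (Hcont z s r _ (locally_between _ _ _ Hr))).
    apply locally_2d_impl, locally_2d_forall; intros r1 r2 Hr2. apply Hplane, Hr2.
  - apply (is_derive_comp (fun z => h (x + r * p) (y + r * q) z t) (fun r => z + r * s));
      [exact (proj1 (proj2 (proj2 (slab_is_derive h _ _ _ t Hh Hr)))) | apply Haff].
  - assert (H1 : forall x p,
      filterlim (fun r : R * R => x + fst r * p) (locally (r, r)) (locally (x + r * p))).
    { intros x' p'. apply (filterlim_comp _ _ _ fst (fun r => x' + r * p') _ (locally r));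
        [apply continuous_fst | apply Hcont]. }
    assert (H2 : filterlim (fun r : R * R => z + snd r * s) (locally (r, r)) (locally (z + r * s))).
    { apply (filterlim_comp _ _ _ snd (fun r => z + r * s) _ (locally r));
        [apply continuous_snd | apply Hcont]. }
    assert (H3 : forall k, slab_smooth 0 a b k ->
      continuity_2d_pt (fun r1 r2 => k (x + r1 * p) (y + r1 * q) (z + r2 * s) t) r r).
    { intros k Hk. apply continuity_2d_pt_filterlim.
      apply (filterlim_slab _ 0 k (fun r => x + fst r * p) (fun r => y + fst r * q)
        (fun r => z + snd r * s) (fun _ => t));
        first [assumption | apply H1 | apply H2 | apply filterlim_const]. }
    apply continuity_2d_pt_plus; apply continuity_2d_pt_mult;
      first [apply continuity_2d_pt_const | apply H3; assumption].
  - apply (is_derive_id (K := R_AbsRing)).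
  - apply (is_derive_id (K := R_AbsRing)).
Qed.

(** * Vanishing by transport from the bed *)

(** [h] is constant along lines of direction [(A1, A2, A3)]. As [A3 <> 0], each of them runs down to
    the bed, where [h] is 0 and is approached continuously within [D]. *)
Lemma slab_zero_of_transport (D : R * R * R * R -> Prop) (h : field) (A1 A2 A3 t : R) :
  continuous_on D (uncurry4 h) ->
  (forall x y z, a <= z < b -> D (x, y, z, t)) ->
  slab_smooth 1 a b h ->
  (forall x y, h x y a t = 0) ->
  A3 <> 0 ->
  (forall x y z, a < z < b ->
     A1 * Dx h x y z t + A2 * Dy h x y z t + A3 * Dz h x y z t = 0) ->
  forall x y z, a < z < b -> h x y z t = 0.
Proof.
  intros HcD HD Hh Hbed HA3 Htr x y z Hz.
  (* Dividing the direction by [A3] gives vertical speed 1, so the line reaches the bed at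
     [r = a - z]. *)
  pose (phi := fun r => h (x + r * (A1 / A3)) (y + r * (A2 / A3)) (z + r * 1) t).
  assert (Hphi : forall r, a - z < r < 0 -> phi r = h x y z t).
  { intros r Hr. transitivity (phi 0).
    - apply (eq_is_derive phi); [|lra]. intros s Hs.
      assert (Hzs : a < z + s * 1 < b) by lra.
      pose proof (slab_is_derive_line h x y z t (A1 / A3) (A2 / A3) 1 s Hh Hzs) as Hd.
      replace (@zero R_NormedModule) with
        (A1 / A3 * Dx h (x + s * (A1 / A3)) (y + s * (A2 / A3)) (z + s * 1) t +
         A2 / A3 * Dy h (x + s * (A1 / A3)) (y + s * (A2 / A3)) (z + s * 1) t +
         1 * Dz h (x + s * (A1 / A3)) (y + s * (A2 / A3)) (z + s * 1) t); [exact Hd|].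
      transitivity (0 / A3); [|unfold Rdiv; rewrite Rmult_0_l; reflexivity].
      rewrite <- (Htr (x + s * (A1 / A3)) (y + s * (A2 / A3)) (z + s * 1) Hzs).
      field; exact HA3.
    - unfold phi. f_equal; ring. }
  assert (Haff : forall x p : R, filterlim (fun r : R => x + r * p) (at_right (a - z))
    (locally (x + (a - z) * p))).
  { intros x' p'. refine (filterlim_filter_le_1 (F := locally (a - z)) _ _ _);
      [apply filter_le_within|].
    apply (ex_derive_continuous (fun r => x' + r * p')). auto_derive; exact I. }
  assert (Hlim : at_right (a - z) (fun r => a - z < r < 0)).
  { unfold at_right, within. generalize (locally_between (a - z - 1) 0 (a - z) ltac:(lra)).
    apply filter_imp; intros r Hr Hr'. lra. }
  symmetry.
  (* As [r] decreases to [a - z], [phi] tends to the value 0 on the bed, but it also equals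
     [h x y z t] all along. *)
  apply (filterlim_locally_unique (F := at_right (a - z)) phi).
  - assert (Ha : z + (a - z) * 1 = a) by ring.
    rewrite <- (Hbed (x + (a - z) * (A1 / A3)) (y + (a - z) * (A2 / A3))).
    pose proof (Haff z 1) as Haz. rewrite Ha in Haz.
    apply (filterlim_field_within _ D h (fun r => x + r * (A1 / A3))
      (fun r => y + r * (A2 / A3)) (fun r => z + r * 1) (fun _ => t));
      [exact HcD | apply HD; lra | apply Haff | apply Haff | exact Haz
      | apply filterlim_const |].
    generalize Hlim. apply filter_imp. intros r Hr. apply HD. lra.
  - apply (filterlim_ext_loc (fun _ => h x y z t)); [|apply filterlim_const].
    generalize Hlim. apply filter_imp. intros r Hr. symmetry; apply Hphi, Hr.
Qed.

(** * The curl of the momentum equations *)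

Lemma is_derive_sum_products (T U X V Y W Z : R -> R) (s dT dU dX dV dY dW dZ : R) :
  is_derive T s dT -> is_derive U s dU -> is_derive X s dX -> is_derive V s dV ->
  is_derive Y s dY -> is_derive W s dW -> is_derive Z s dZ ->
  is_derive (fun s => T s + U s * X s + V s * Y s + W s * Z s) s
    (dT + (dU * X s + U s * dX) + (dV * Y s + V s * dY) + (dW * Z s + W s * dZ)).
Proof.
  intros HT HU HX HV HY HW HZ.
  auto_derive.
  - repeat split; eexists; eassumption.
  - rewrite (is_derive_unique (fun r : R => T r) _ _ HT),
      (is_derive_unique (fun r : R => U r) _ _ HU),
      (is_derive_unique (fun r : R => X r) _ _ HX), (is_derive_unique (fun r : R => V r) _ _ HV),
      (is_derive_unique (fun r : R => Y r) _ _ HY), (is_derive_unique (fun r : R => W r) _ _ HW),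
      (is_derive_unique (fun r : R => Z r) _ _ HZ). ring.
Qed.

Lemma is_derive_eq (f : R -> R) (x l1 l2 : R) :
  is_derive f x l1 -> l1 = l2 -> is_derive f x l2.
Proof. intros H <-. exact H. Qed.

(** After the product rule, the symmetry of mixed derivatives regroups the second-order terms into
    the material derivative of a partial derivative of [h]. *)
Lemma slab_is_derive_material (u v w h : field) x y z t :
  slab_smooth 2 a b u -> slab_smooth 2 a b v -> slab_smooth 2 a b w ->
  slab_smooth 2 a b h -> a < z < b ->
  is_derive (fun s => material_derivative u v w h s y z t) x
    (material_derivative u v w (Dx h) x y z t + Dx u x y z t * Dx h x y z t
     + Dx v x y z t * Dy h x y z t + Dx w x y z t * Dz h x y z t) /\
  is_derive (fun s => material_derivative u v w h x s z t) y
    (material_derivative u v w (Dy h) x y z t + Dy u x y z t * Dx h x y z t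
     + Dy v x y z t * Dy h x y z t + Dy w x y z t * Dz h x y z t) /\
  is_derive (fun s => material_derivative u v w h x y s t) z
    (material_derivative u v w (Dz h) x y z t + Dz u x y z t * Dx h x y z t
     + Dz v x y z t * Dy h x y z t + Dz w x y z t * Dz h x y z t).
Proof.
  intros Hu Hv Hw Hh Hz.
  destruct (slab_schwarz h x y z t Hh Hz) as (Sxy & Sxz & Syz & Sxt & Syt & Szt).
  destruct Hh as (_ & _ & Hx & Hy & Hhz & Ht).
  apply slab_smooth_pred in Hu, Hv, Hw.
  destruct (slab_is_derive u x y z t Hu Hz) as (ux & uy & uz & _).
  destruct (slab_is_derive v x y z t Hv Hz) as (vx & vy & vz & _).
  destruct (slab_is_derive w x y z t Hw Hz) as (wx & wy & wz & _).
  destruct (slab_is_derive _ x y z t Hx Hz) as (xx & xy & xz & _).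
  destruct (slab_is_derive _ x y z t Hy Hz) as (yx & yy & yz & _).
  destruct (slab_is_derive _ x y z t Hhz Hz) as (zx & zy & zz & _).
  destruct (slab_is_derive _ x y z t Ht Hz) as (tx & ty & tz & _).
  unfold material_derivative.
  split; [|split].
  - eapply is_derive_eq; [eapply is_derive_sum_products; eassumption|].
    rewrite Sxy, Sxz, Sxt. ring.
  - eapply is_derive_eq; [eapply is_derive_sum_products; eassumption|].
    rewrite <- Sxy, Syz, Syt. ring.
  - eapply is_derive_eq; [eapply is_derive_sum_products; eassumption|].
    rewrite <- Sxz, <- Syz, Szt. ring.
Qed.

(** Meant for the two terms of a vorticity component: their difference is constant, so their first
    derivatives agree. *)
Lemma slab_material_eq (u v w h k : field) (K : R) x y z t :
  slab_smooth 1 a b h -> slab_smooth 1 a b k ->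
  (forall x y z t, a < z < b -> h x y z t - k x y z t = K) -> a < z < b ->
  material_derivative u v w h x y z t = material_derivative u v w k x y z t.
Proof.
  intros Hh Hk Hc Hz.
  assert (H1 : forall f g : R -> R, forall s df dg, locally s (fun s => f s - g s = K) ->
    is_derive f s df -> is_derive g s dg -> df = dg).
  { intros f g s df dg Hl Hf Hg.
    rewrite <- (is_derive_unique _ _ _ Hf).
    apply is_derive_unique.
    apply (is_derive_ext_loc (fun s => g s + K)).
    - generalize Hl. apply filter_imp. intros r Hr. simpl in *; lra.
    - auto_derive; [eexists; eassumption|].
      rewrite (is_derive_unique (fun r : R => g r) _ _ Hg). ring. }
  destruct (slab_is_derive h x y z t Hh Hz) as (hx & hy & hz & ht).
  destruct (slab_is_derive k x y z t Hk Hz) as (kx & ky & kz & kt).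
  pose proof (locally_between _ _ _ Hz) as Hl.
  unfold material_derivative.
  rewrite (H1 _ _ _ _ _ (filter_forall _ (fun s => Hc s y z t Hz)) hx kx).
  rewrite (H1 _ _ _ _ _ (filter_forall _ (fun s => Hc x s z t Hz)) hy ky).
  rewrite (H1 _ _ _ _ _ (filter_imp _ _ (fun s => Hc x y s t) Hl) hz kz).
  rewrite (H1 _ _ _ _ _ (filter_forall _ (fun s => Hc x y z s Hz)) ht kt).
  reflexivity.
Qed.

(** Take the curl of the momentum equations: the advection of the constant
    vorticity drops out. *)
Lemma slab_vorticity_equation (u v w P : field)
    (Y1 Y2 Y3 F Fh rho k K1 K2 K3 : R) x y z t :
  slab_smooth 2 a b u -> slab_smooth 2 a b v -> slab_smooth 2 a b w ->
  slab_smooth 2 a b P ->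
  (forall x y z t, a < z < b ->
    material_derivative u v w u x y z t + Fh * w x y z t - F * v x y z t
    = rho * Dx P x y z t) ->
  (forall x y z t, a < z < b ->
    material_derivative u v w v x y z t + F * u x y z t + k * y + K2
    = rho * Dy P x y z t) ->
  (forall x y z t, a < z < b ->
    material_derivative u v w w x y z t - Fh * u x y z t - K3
    = rho * Dz P x y z t - K1) ->
  (forall x y z t, a < z < b ->
    Dx u x y z t + Dy v x y z t + Dz w x y z t = 0) ->
  (forall x y z t, a < z < b ->
    Dy w x y z t - Dz v x y z t = Y1 /\
    Dz u x y z t - Dx w x y z t = Y2 /\
    Dx v x y z t - Dy u x y z t = Y3) ->
  a < z < b ->
  Y1 * Dx u x y z t + (Y2 + Fh) * Dy u x y z t + (Y3 + F) * Dz u x y z t = 0 /\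
  Y1 * Dx v x y z t + (Y2 + Fh) * Dy v x y z t + (Y3 + F) * Dz v x y z t = 0 /\
  Y1 * Dx w x y z t + (Y2 + Fh) * Dy w x y z t + (Y3 + F) * Dz w x y z t = 0.
Proof.
  intros Hu Hv Hw HP Emx Emy Emz Hdiv Hvort Hz.
  pose proof (locally_between _ _ _ Hz) as Hl.
  destruct (slab_schwarz P x y z t HP Hz) as (Sxy & Sxz & Syz & _).
  destruct (slab_is_derive_material u v w u x y z t Hu Hv Hw Hu Hz) as (_ & muy & muz).
  destruct (slab_is_derive_material u v w v x y z t Hu Hv Hw Hv Hz) as (mvx & _ & mvz).
  destruct (slab_is_derive_material u v w w x y z t Hu Hv Hw Hw Hz) as (mwx & mwy & _).
  pose proof (slab_material_eq u v w (Dy w) (Dz v) Y1 x y z t) as C1.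
  pose proof (slab_material_eq u v w (Dz u) (Dx w) Y2 x y z t) as C2.
  pose proof (slab_material_eq u v w (Dx v) (Dy u) Y3 x y z t) as C3.
  specialize (C1 ltac:(apply Hw) ltac:(apply Hv) ltac:(apply Hvort) Hz).
  specialize (C2 ltac:(apply Hu) ltac:(apply Hw) ltac:(apply Hvort) Hz).
  specialize (C3 ltac:(apply Hv) ltac:(apply Hu) ltac:(apply Hvort) Hz).
  destruct HP as (_ & _ & HPx & HPy & HPz & _).
  apply slab_smooth_pred in Hu, Hv, Hw.
  destruct (slab_is_derive u x y z t Hu Hz) as (ux & uy & uz & _).
  destruct (slab_is_derive v x y z t Hv Hz) as (vx & vy & vz & _).
  destruct (slab_is_derive w x y z t Hw Hz) as (wx & wy & wz & _).
  destruct (slab_is_derive _ x y z t HPx Hz) as (_ & Pxy & Pxz & _).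
  destruct (slab_is_derive _ x y z t HPy Hz) as (Pyx & _ & Pyz & _).
  destruct (slab_is_derive _ x y z t HPz Hz) as (Pzx & Pzy & _).
  (* Template for differentiating one momentum equation in one variable: [M] is the material
     derivative, [A * U + B * V] the Coriolis part, and [D] whatever is constant in that
     variable. *)
  assert (H : forall (M U V Q : R -> R) (A B D s dM dU dV dQ : R),
    locally s (fun s => M s + A * U s + B * V s + D = rho * Q s) ->
    is_derive M s dM -> is_derive U s dU -> is_derive V s dV -> is_derive Q s dQ ->
    dM + A * dU + B * dV = rho * dQ).
  { intros M U V Q A B D s dM dU dV dQ Hl' HM HU HV HQ.
    transitivity (Derive (fun s => rho * Q s) s).
    - symmetry. apply is_derive_unique.
      apply (is_derive_ext_loc (fun s => M s + A * U s + B * V s + D));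
        [exact Hl'|].
      auto_derive; [repeat split; eexists; eassumption|].
      rewrite (is_derive_unique (fun r : R => M r) _ _ HM),
        (is_derive_unique (fun r : R => U r) _ _ HU),
        (is_derive_unique (fun r : R => V r) _ _ HV). ring.
    - rewrite Derive_scal, (is_derive_unique _ _ _ HQ). reflexivity. }
  pose proof (fun E => H _ _ _ _ Fh (- F) 0 y _ _ _ _ E
    muy wy vy Pxy) as Exy.
  specialize (Exy ltac:(apply filter_forall; intros s;
    generalize (Emx x s z t Hz); simpl; lra)).
  pose proof (fun E => H _ _ _ _ Fh (- F) 0 z _ _ _ _ E
    muz wz vz Pxz) as Exz.
  specialize (Exz ltac:(generalize Hl; apply filter_imp; intros s Hs;
    generalize (Emx x y s t Hs); simpl; lra)).
  (* The curl differentiates the second equation in x and z only, so the centripetal term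
     [k * y + K2] counts as a constant. *)
  pose proof (fun E => H _ _ _ _ F 0 (k * y + K2) x _ _ _ _ E
    mvx ux vx Pyx) as Eyx.
  specialize (Eyx ltac:(apply filter_forall; intros s;
    generalize (Emy s y z t Hz); simpl; lra)).
  pose proof (fun E => H _ _ _ _ F 0 (k * y + K2) z _ _ _ _ E
    mvz uz vz Pyz) as Eyz.
  specialize (Eyz ltac:(generalize Hl; apply filter_imp; intros s Hs;
    generalize (Emy x y s t Hs); simpl; lra)).
  pose proof (fun E => H _ _ _ _ (- Fh) 0 (K1 - K3) x _ _ _ _ E
    mwx ux vx Pzx) as Ezx.
  specialize (Ezx ltac:(apply filter_forall; intros s;
    generalize (Emz s y z t Hz); simpl; lra)).
  pose proof (fun E => H _ _ _ _ (- Fh) 0 (K1 - K3) y _ _ _ _ E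
    mwy uy vy Pzy) as Ezy.
  specialize (Ezy ltac:(apply filter_forall; intros s;
    generalize (Emz x s z t Hz); simpl; lra)).
  (* Equating the mixed derivatives of [P] eliminates the pressure from each pair of equations. *)
  rewrite Sxy in Eyx. rewrite Sxz in Ezx. rewrite Syz in Ezy.
  destruct (Hvort x y z t Hz) as (V1 & V2 & V3).
  pose proof (Hdiv x y z t Hz) as V0.
  clear - C1 C2 C3 V0 V1 V2 V3 Exy Exz Eyx Eyz Ezx Ezy.
  (* With the vorticity written out and [Dz w] eliminated by incompressibility, each claim is a
     linear combination of the relations above, products of derivatives being treated as
     unknowns. *)
  assert (W : Dz w x y z t = - Dx u x y z t - Dy v x y z t) by lra.
  rewrite <- V1, <- V2, <- V3. rewrite W in *.
  split; [|split]; lra.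
Qed.

End Slab.

(** * Functions of one real variable *)

(** Subtracting the quadratic leaves a function of derivative 0. With [B = 0] this also covers
    constant derivatives. *)
Lemma eq_quadratic_of_affine_derive (f : R -> R) (A B : R) :
  (forall x, is_derive f x (A + B * x)) -> forall x, f x = f 0 + A * x + B / 2 * x ^ 2.
Proof.
  intros Hf x.
  pose (g := fun s => f s - (A * s + B / 2 * s ^ 2)).
  assert (Hg : forall s, is_derive g s 0).
  { intros s. unfold g. auto_derive; [eexists; apply Hf|].
    rewrite (is_derive_unique (fun r : R => f r) _ _ (Hf s)). simpl. field. }
  assert (H : g x = g 0).
  { destruct (Rtotal_order x 0) as [Hx | [-> | Hx]]; [|reflexivity|symmetry];
      apply (eq_is_derive g); auto; intros; apply Hg. }
  unfold g in H. simpl in *. lra.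
Qed.

Lemma bounded_constant_derive (f : R -> R) (K : R) :
  (exists B, forall x, Rabs (f x) <= B) -> (forall x, is_derive f x K) -> K = 0.
Proof.
  intros [B HB] Hf.
  destruct (Req_dec K 0) as [|HK]; [assumption|exfalso].
  (* The point [(2 * B + 1) / K] is chosen so that [f] grows by [2 * B + 1] from 0, more than values
     in [[- B, B]] allow. *)
  assert (Haff := eq_quadratic_of_affine_derive f K 0
    (fun x => is_derive_eq f x _ (K + 0 * x) (Hf x) ltac:(ring)) ((2 * B + 1) / K)).
  assert (Hv : f ((2 * B + 1) / K) = f 0 + (2 * B + 1)) by (rewrite Haff; field; exact HK).
  pose proof (proj1 (Rabs_le_between _ _) (HB 0)).
  pose proof (proj1 (Rabs_le_between _ _) (HB ((2 * B + 1) / K))). lra.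
Qed.

(** A minimum over the compact interval [[0, L]] is global by periodicity. Applied to [eta], it
    yields a trough. *)
Lemma periodic_continuous_min (f : R -> R) (L : R) :
  0 < L -> (forall s, continuity_pt f s) -> (forall s, f (s + L) = f s) ->
  exists m, forall s, f m <= f s.
Proof.
  intros HL Hc Hper.
  destruct (continuity_ab_min f 0 L) as [m [Hm _]]; [lra | intros; apply Hc |].
  exists m; intros s.
  assert (Hnat : forall (n : nat) r, f (r + INR n * L) = f r).
  { induction n as [|n IH]; intros r.
    - simpl. f_equal; ring.
    - rewrite S_INR, <- (IH r), <- (Hper (r + INR n * L)). f_equal; ring. }
  assert (HZ : forall (n : Z) r, f (r + IZR n * L) = f r).
  { intros n r. destruct (Z.le_ge_cases 0 n) as [Hn | Hn].
    - rewrite <- (Z2Nat.id n Hn), <- INR_IZR_INZ. apply Hnat.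
    - rewrite <- (Hnat (Z.to_nat (- n)) (r + IZR n * L)), INR_IZR_INZ, Z2Nat.id, opp_IZR by lia.
      f_equal; ring. }
  (* Removing the integer part of [s / L] periods moves [s] into [[0, L]]. *)
  rewrite <- (HZ (- Int_part (s / L))%Z s), opp_IZR.
  apply Hm.
  destruct (base_Int_part (s / L)) as [H1 H2].
  set (n := IZR (Int_part (s / L))) in *.
  assert (Hs : s = s / L * L) by (field; lra).
  set (q := s / L) in *. rewrite Hs.
  split; nra.
Qed.

(** * Horizontal flow: rigidity of the velocity and shape of the pressure *)

Section HorizontalFlow.

Context {a b : R} {u v w P : field} {Y1 Y2 Y3 A2 A3 : R}.
Hypothesis Hu : slab_smooth 1 a b u.
Hypothesis Hv : slab_smooth 1 a b v.
Hypothesis Hw0 : forall x y z t, a < z < b -> w x y z t = 0.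
Hypothesis Hdiv : forall x y z t, a < z < b ->
  Dx u x y z t + Dy v x y z t + Dz w x y z t = 0.
Hypothesis Hvort : forall x y z t, a < z < b ->
  Dy w x y z t - Dz v x y z t = Y1 /\
  Dz u x y z t - Dx w x y z t = Y2 /\
  Dx v x y z t - Dy u x y z t = Y3.

(** All space derivatives of [w] vanish in the open slab, so vorticity and incompressibility leave
    only [Dx u] and [Dy u] undetermined. *)
Lemma horizontal_gradients x y z t : a < z < b ->
  Dz u x y z t = Y2 /\ Dz v x y z t = - Y1 /\
  Dx v x y z t = Y3 + Dy u x y z t /\ Dy v x y z t = - Dx u x y z t.
Proof.
  intros Hz.
  assert (wx : Dx w x y z t = 0).
  { unfold Dx. rewrite (Derive_ext _ (fun _ => 0)); [apply Derive_const|].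
    intros s; apply Hw0, Hz. }
  assert (wy : Dy w x y z t = 0).
  { unfold Dy. rewrite (Derive_ext _ (fun _ => 0)); [apply Derive_const|].
    intros s; apply Hw0, Hz. }
  assert (wz : Dz w x y z t = 0).
  { unfold Dz. rewrite (Derive_ext_loc _ (fun _ => 0)); [apply Derive_const|].
    generalize (locally_between _ _ _ Hz). apply filter_imp; intros s; apply Hw0. }
  destruct (Hvort x y z t Hz) as (V1 & V2 & V3). pose proof (Hdiv x y z t Hz).
  repeat split; lra.
Qed.

(** The two transport equations form a linear system for [(Dx u, Dy u)] with
    constant coefficients and determinant [- (Y1 ^ 2 + A2 ^ 2)], so this gradient
    is constant, and a bounded function of constant derivative has derivative 0. *)
Lemma bounded_horizontal_gradient_zero :
  A2 <> 0 ->
  (forall t, exists B, forall x y z, a < z < b -> Rabs (u x y z t) <= B) ->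
  (forall x y z t, a < z < b ->
    Y1 * Dx u x y z t + A2 * Dy u x y z t + A3 * Dz u x y z t = 0 /\
    Y1 * Dx v x y z t + A2 * Dy v x y z t + A3 * Dz v x y z t = 0) ->
  forall x y z t, a < z < b -> Dx u x y z t = 0 /\ Dy u x y z t = 0.
Proof.
  intros HA2 Hb Htr x0 y0 z t Hz.
  pose (D := Y1 ^ 2 + A2 ^ 2).
  assert (HD : D <> 0).
  { assert (0 < D); [|lra]. unfold D.
    pose proof (pow2_ge_0 Y1). pose proof (pow2_gt_0 _ HA2). lra. }
  assert (Hgrad : forall x y,
    Dx u x y z t = (- A3 * Y2 * Y1 + A2 * Y1 * (Y3 - A3)) / D /\
    Dy u x y z t = (- A3 * Y2 * A2 - Y1 ^ 2 * (Y3 - A3)) / D).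
  { intros x y.
    destruct (horizontal_gradients x y z t Hz) as (uz & vz & vx & vy).
    destruct (Htr x y z t Hz) as [E1 E2].
    rewrite uz in E1. rewrite vz, vx, vy in E2.
    generalize dependent (Dx u x y z t). generalize dependent (Dy u x y z t).
    intros q _ p _ E1 E2.
    split; apply (Rmult_eq_reg_r D); try exact HD;
      unfold Rdiv; rewrite Rmult_assoc, Rinv_l, Rmult_1_r by exact HD; unfold D.
    (* Cramer's rule, with [p] for [Dx u] and [q] for [Dy u]: the two equations have left sides
       equal to 0 and are added with multipliers [- Y1] and [A2] to isolate [p], then with [- A2]
       and [- Y1] to isolate [q]. *)
    - transitivity (p * (Y1 ^ 2 + A2 ^ 2)
        - Y1 * (Y1 * p + A2 * q + A3 * Y2)
        + A2 * (Y1 * (Y3 + q) + A2 * - p + A3 * - Y1)); [rewrite E1, E2|]; ring.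
    - transitivity (q * (Y1 ^ 2 + A2 ^ 2)
        - A2 * (Y1 * p + A2 * q + A3 * Y2)
        - Y1 * (Y1 * (Y3 + q) + A2 * - p + A3 * - Y1)); [rewrite E1, E2|]; ring. }
  destruct (Hb t) as [B HB].
  split.
  - apply (bounded_constant_derive (fun s => u s y0 z t)).
    + exists B; intros; apply HB, Hz.
    + intros x. rewrite (proj1 (Hgrad x0 y0)), <- (proj1 (Hgrad x y0)).
      exact (proj1 (slab_is_derive u _ _ _ t Hu Hz)).
  - apply (bounded_constant_derive (fun s => u x0 s z t)).
    + exists B; intros; apply HB, Hz.
    + intros y. rewrite (proj2 (Hgrad x0 y0)), <- (proj2 (Hgrad x0 y)).
      exact (proj1 (proj2 (slab_is_derive u _ _ _ t Hu Hz))).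
Qed.

(** [Dy P] is affine in y with slope [k / rho], so the second difference over y = -1, 0, 1 isolates
    this slope. It involves only values of [P] and hence passes to the limit at the surface. Here
    [rho] is the factor in front of [Dy P]. *)
Lemma pressure_second_difference (F rho k K : R) :
  rho <> 0 -> slab_smooth 1 a b P ->
  (forall x y z t, a < z < b -> Dx u x y z t = 0 /\ Dy u x y z t = 0) ->
  (forall x y z t, a < z < b ->
    material_derivative u v w v x y z t + F * u x y z t + k * y + K
    = rho * Dy P x y z t) ->
  forall x z t, a < z < b -> P x 1 z t + P x (-1) z t - 2 * P x 0 z t = k / rho.
Proof.
  intros Hrho HP Hgrad Hmom x z t Hz.
  assert (Huy : forall y, u x y z t = u x 0 z t).
  { intros y. transitivity (u x 0 z t + 0 * y + 0 / 2 * y ^ 2); [|field].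
    apply (eq_quadratic_of_affine_derive (fun s => u x s z t)).
    intros s. apply (is_derive_eq _ _ (Dy u x s z t));
      [exact (proj1 (proj2 (slab_is_derive u _ _ _ t Hu Hz)))|].
    rewrite (proj2 (Hgrad x s z t Hz)). ring. }
  (* All times are included because [Dt v] must be independent of y as well. *)
  assert (Hvy : forall y s, v x y z s = v x 0 z s).
  { intros y r. transitivity (v x 0 z r + 0 * y + 0 / 2 * y ^ 2); [|field].
    apply (eq_quadratic_of_affine_derive (fun s => v x s z r)).
    intros s. apply (is_derive_eq _ _ (Dy v x s z r));
      [exact (proj1 (proj2 (slab_is_derive v _ _ _ r Hv Hz)))|].
    destruct (horizontal_gradients x s z r Hz) as (_ & _ & _ & ->).
    rewrite (proj1 (Hgrad x s z r Hz)). ring. }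
  (* The part of the second momentum equation that is free of y: since [Dx v = Y3], [Dy v = 0] and
     [w = 0], the advection of [v] reduces to [u * Y3]. *)
  pose (C := Dt v x 0 z t + u x 0 z t * Y3 + F * u x 0 z t + K).
  assert (HPy : forall y, is_derive (fun s => P x s z t) y (C / rho + k / rho * y)).
  { intros y. apply (is_derive_eq _ _ (Dy P x y z t));
      [exact (proj1 (proj2 (slab_is_derive P _ _ _ t HP Hz)))|].
    apply (Rmult_eq_reg_l rho); [|exact Hrho].
    rewrite <- (Hmom x y z t Hz). unfold material_derivative.
    destruct (horizontal_gradients x y z t Hz) as (_ & _ & -> & ->).
    destruct (Hgrad x y z t Hz) as [-> ->].
    rewrite (Hw0 x y z t Hz), (Huy y).
    assert (HDt : Dt v x y z t = Dt v x 0 z t) by (apply Derive_ext; intros; apply Hvy).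
    rewrite HDt. unfold C. field; exact Hrho. }
  pose proof (eq_quadratic_of_affine_derive _ _ _ HPy 1) as E1.
  pose proof (eq_quadratic_of_affine_derive _ _ _ HPy (-1)) as E2.
  simpl in E1, E2. rewrite E1, E2. field; exact Hrho.
Qed.

End HorizontalFlow.

(** * The contradiction at a trough *)

Theorem theorem3p1 (Omega Rad g rho Patm d c L phi : R)
    (hOmega : 0 < Omega) (hRad : 0 < Rad) (hg : 0 < g) (hrho : 0 < rho)
    (hd : 0 < d) (hc : 0 < c) (hL : 0 < L)
    (hphi : - (PI / 2) < phi < PI / 2)
    (Y1 Y2 Y3 : R)
    (hY2 : Y2 + coriolis_hat Omega phi <> 0)
    (hY3 : Y3 + coriolis Omega phi <> 0) :
  ~ exists (u v w P : field) (eta : R -> R),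
      f_plane_solution Omega Rad g rho Patm d c L phi u v w P eta /\
      constant_vorticity d c eta u v w Y1 Y2 Y3 /\
      bounded_velocity d c eta u v w.
Proof.
  intros (u & v & w & P & eta & [Hsurf Hu Hv Hw HP Emx Emy Emz Hdiv Hdyn _ Hbed] & Hvort & Hbd).
  destruct Hsurf as [Hdiff Hper Hbelow _ _ _].
  destruct (periodic_continuous_min eta L hL) as [x0 Hmin]; [|exact Hper|].
  { intros s. apply continuity_pt_filterlim.
    apply (ex_derive_continuous eta), Hdiff. }
  set (b := eta x0) in *.
  assert (Hin : forall x y z t, - d < z < b -> in_interior d c eta x y z t).
  { intros x y z t Hz. specialize (Hmin (x - c * t)). unfold in_interior; lra. }
  assert (Hfl : forall x y z t, - d <= z <= b -> in_fluid d c eta x y z t).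
  { intros x y z t Hz. specialize (Hmin (x - c * t)). unfold in_fluid; lra. }
  assert (Hab : - d < b) by apply Hbelow.
  destruct Hu as [_ Hu], Hv as [_ Hv], Hw as [Hwc Hw], HP as [HPc HP].
  apply (partials_extend_slab _ _ _ _ b) in Hu, Hv, Hw, HP; try exact Hmin.
  set (Fh := coriolis_hat Omega phi) in *. set (F := coriolis Omega phi) in *.
  pose proof (fun x y z t Hz => Hvort x y z t (Hin x y z t Hz)) as Hvort'.
  pose proof (fun x y z t Hz => Hdiv x y z t (Hin x y z t Hz)) as Hdiv'.
  (* The factor [rho] of the lemma is [- (1 / rho)] here, and [Fh ^ 2 / 4] is the centripetal
     coefficient [k]. *)
  assert (Htr := fun x y z t => slab_vorticity_equation u v w P Y1 Y2 Y3 F Fh (- (1 / rho))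
    (Fh ^ 2 / 4) g (Fh * F / 4 * Rad) (Fh ^ 2 / 4 * Rad) x y z t Hu Hv Hw HP
    (fun x y z t Hz => Emx x y z t (Hin x y z t Hz))
    (fun x y z t Hz => Emy x y z t (Hin x y z t Hz))
    (fun x y z t Hz => Emz x y z t (Hin x y z t Hz)) Hdiv' Hvort').
  assert (Hw0 : forall x y z t, - d < z < b -> w x y z t = 0).
  { intros x y z t. revert x y z.
    (* The condition [hY3] makes the absolute vorticity transversal to the bed. *)
    apply (slab_zero_of_transport (fluid_set d c eta) w Y1 (Y2 + Fh) (Y3 + F)); auto.
    - intros x y z Hz. apply Hfl; lra.
    - apply slab_smooth_pred, Hw.
    - intros x y z Hz. apply Htr, Hz. }
  apply slab_smooth_pred in Hu, Hv, HP.
  assert (Hgrad : forall x y z t, - d < z < b -> Dx u x y z t = 0 /\ Dy u x y z t = 0).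
  (* The condition [hY2] makes the determinant of the linear system nonzero. *)
  { apply (bounded_horizontal_gradient_zero Hu Hw0 Hdiv' Hvort' (A3 := Y3 + F) hY2).
    - intros t. destruct (Hbd t) as [B HB]. exists B; intros x y z Hz. apply HB, Hfl; lra.
    - intros x y z t Hz. destruct (Htr x y z t Hz) as (H1 & H2 & _). auto. }
  assert (Hr : - (1 / rho) <> 0).
  { assert (0 < 1 / rho) by (apply Rdiv_lt_0_compat; lra). lra. }
  assert (Hsd := pressure_second_difference Hu Hv Hw0 Hdiv' Hvort' F (- (1 / rho))
    (Fh ^ 2 / 4) (Fh * F / 4 * Rad) Hr HP Hgrad
    (fun x y z t Hz => Emy x y z t (Hin x y z t Hz)) x0).
  (* The cosine is positive at latitudes strictly between the poles. *)
  assert (HF : Fh <> 0).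
  { assert (0 < Fh); [|lra]. apply Rmult_lt_0_compat; [lra|]. apply cos_gt_0; lra. }
  assert (Hslab : at_left b (fun z => - d < z < b)).
  { unfold at_left, within. generalize (locally_between (- d) (b + 1) b ltac:(lra)).
    apply filter_imp; intros z Hz Hzb. lra. }
  (* At time 0 the vertical lines over [x0] meet the surface exactly at height [b]. Approached from
     below within the fluid, the pressure tends to [Patm] there for every y. *)
  assert (HPlim : forall y, filterlim (fun z => P x0 y z 0) (at_left b) (locally Patm)).
  { intros y.
    assert (Hb : eta (x0 - c * 0) = b) by (unfold b; f_equal; ring).
    rewrite <- (Hdyn x0 y 0), Hb.
    apply (filterlim_field_within _ (fluid_set d c eta) P
      (fun _ => x0) (fun _ => y) (fun z => z) (fun _ => 0));
      try apply filterlim_const.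
    - exact HPc.
    - apply Hfl; lra.
    - refine (filterlim_filter_le_1 (F := locally b) _ _ _);
        [apply filter_le_within | apply filterlim_id].
    - generalize Hslab. apply filter_imp. intros z Hz. apply Hfl; lra. }
  (* The second difference is constant in the slab, yet tends to [Patm + Patm - 2 * Patm = 0] at the
     trough. *)
  assert (H0 : Fh ^ 2 / 4 / - (1 / rho) = 0).
  { apply (filterlim_locally_unique (F := at_left b)
      (fun z => P x0 1 z 0 + P x0 (-1) z 0 - 2 * P x0 0 z 0)).
    - apply (filterlim_ext_loc (fun _ => Fh ^ 2 / 4 / - (1 / rho))); [|apply filterlim_const].
      generalize Hslab. apply filter_imp. intros z Hz. symmetry; apply Hsd, Hz.
    - assert (Hl : filterlim
        (fun z => plus (plus (P x0 1 z 0) (P x0 (-1) z 0)) (scal (-2) (P x0 0 z 0)))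
        (at_left b) (locally (plus (plus Patm Patm) (scal (-2) Patm)))).
      { refine (filterlim_comp_2 _ _ _ (filterlim_comp_2 _ _ _ (HPlim 1) (HPlim (-1)) _)
          (filterlim_comp _ _ _ _ _ _ _ _ (HPlim 0)
            (filterlim_scal_r (V := R_NormedModule) (-2) Patm)) _);
          apply (filterlim_plus (V := R_NormedModule)). }
      assert (H0 : plus (plus Patm Patm) (scal (-2) Patm) = 0).
      { change (Patm + Patm + -2 * Patm = 0). ring. }
      rewrite H0 in Hl. revert Hl. apply filterlim_ext. intros z.
      change (P x0 1 z 0 + P x0 (-1) z 0 + -2 * P x0 0 z 0
        = P x0 1 z 0 + P x0 (-1) z 0 - 2 * P x0 0 z 0). ring. }
  apply (Rmult_integral_contrapositive_currified (Fh ^ 2 / 4) (/ - (1 / rho))); [| |exact H0].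
  - pose proof (pow2_gt_0 _ HF). lra.
  - apply Rinv_neq_0_compat, Hr.
Qed.
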